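(* Let $\mathcal H_1,\mathcal H_2,\mathcal K$ be finite-dimensional complex Hilbert spaces and let $V_1:\mathcal H_1\to\mathcal H_1\otimes\mathcal K$ and $V_2:\mathcal H_2\to\mathcal H_2\otimes\mathcal K$ be isometries whose associated quantum channels are irreducible, with stationary states $\rho^{\rm ss}_1$ and $\rho^{\rm ss}_2$ and Kraus operators $\{K_{1,i}\}_{i=1}^k$, $\{K_{2,i}\}_{i=1}^k$ respectively (with respect to the same orthonormal basis of $\mathcal K$). The following are equivalent: (i) $V_1$ and $V_2$ are output equivalent, i.e. $\rho^{\rm out}_{V_1}(n)=\rho^{\rm out}_{V_2}(n)$ for all $n\in\mathbb N$; (ii) there exist a unitary $W:\mathcal H_2\to\mathcal H_1$ and a complex phase $e^{i\omega}$ such that $K_{2,i}=e^{i\omega}W^*K_{1,i}W$ for all $i=1,\dots,k$ and $\rho^{\rm ss}_2=W^*\rho^{\rm ss}_1W$; (iii) there exist a unitary $W:\mathcal H_2\to\mathcal H_1$ and a complex phase $e^{i\omega}$ such that $(W\otimes\mathbf 1_{\mathcal K})V_2=e^{i\omega}V_1W$.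
   Context: Let $\mathcal K=\mathbb C^k$ with fixed orthonormal basis $|1\rangle,\dots,|k\rangle$. For an isometry $V:\mathcal H\to\mathcal H\otimes\mathcal K$ the Kraus operators $K_i$ on $\mathcal H$ are defined by $V|\psi\rangle=\sum_{i=1}^kK_i|\psi\rangle\otimes|i\rangle$. The associated channel is $\mathcal T_V(X)=V^*(X\otimes\mathbf 1_{\mathcal K})V=\sum_iK_i^*XK_i$, with predual $\mathcal T_{V*}(\rho)=\sum_iK_i\rho K_i^*$. The channel (or $V$) is called irreducible if there is a unique state (density matrix) $\rho^{\rm ss}>0$ with $\mathcal T_{V*}(\rho^{\rm ss})=\rho^{\rm ss}$; $\rho^{\rm ss}$ is the stationary state. The $n$-step isometry $V(n):\mathcal H\to\mathcal H\otimes\mathcal K^{\otimes n}$ is $V(n)|\psi\rangle=\sum_{i_1,\dots,i_n}K_{i_n}\cdots K_{i_1}|\psi\rangle\otimes|i_1\rangle\otimes\cdots\otimes|i_n\rangle$, and the stationary output state is $\rho^{\rm out}_V(n)={\rm Tr}_{\mathcal H}[V(n)\rho^{\rm ss}V(n)^*]$, a density matrix on $\mathcal K^{\otimes n}$. *)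

(* Defs.v *)
From HB Require Import structures.
From mathcomp Require Import all_boot all_order all_algebra.
From mathcomp Require Import complex mxtens.
From mathcomp Require Import reals trigo.

Set Implicit Arguments.
Unset Strict Implicit.
Unset Printing Implicit Defensive.

Import Order.TTheory GRing.Theory Num.Theory.
Local Open Scope ring_scope.

(* A Hilbert space of dimension d is given by its coordinates in an orthonormal
   basis: vectors are columns 'cV_d, operators H -> H' are matrices 'M_(d', d)
   acting on the left, and H (x) H' has dimension d * d', the product basis
   being enumerated by mxtens_index (the convention of *t). *)

Definition adjmx {C : numClosedFieldType} {m n : nat} (A : 'M[C]_(m, n)) :
  'M[C]_(n, m) := (map_mx Num.conj A)^T.

Definition isometric {C : numClosedFieldType} {m n : nat} (A : 'M[C]_(m, n)) :=
  adjmx A *m A = 1%:M.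

(* The two dimensions are not assumed to agree, so both equations are needed. *)
Definition unitary {C : numClosedFieldType} {m n : nat} (A : 'M[C]_(m, n)) :=
  adjmx A *m A = 1%:M /\ A *m adjmx A = 1%:M.

(* In a numClosedFieldType, 0 <= z means that z is real and nonnegative (and
   similarly for <), so the next two predicates force A to be Hermitian. *)
Definition psd {C : numClosedFieldType} {d : nat} (A : 'M[C]_d) :=
  forall v : 'cV[C]_d, 0 <= (adjmx v *m A *m v) 0 0.

Definition posdef {C : numClosedFieldType} {d : nat} (A : 'M[C]_d) :=
  forall v : 'cV[C]_d, v != 0 -> 0 < (adjmx v *m A *m v) 0 0.

Definition density {C : numClosedFieldType} {d : nat} (rho : 'M[C]_d) :=
  psd rho /\ \tr rho = 1.

Definition ket {C : numClosedFieldType} {k : nat} (i : 'I_k) : 'cV[C]_k :=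
  delta_mx i 0.

(* Characterized by kraus_expansion below. *)
Definition kraus {C : numClosedFieldType} {d k : nat}
    (V : 'M[C]_(d * k, d)) (i : 'I_k) : 'M[C]_d :=
  \matrix_(a, b) V (mxtens_index (a, i)) b.

Definition predual {C : numClosedFieldType} {d k : nat}
    (V : 'M[C]_(d * k, d)) (rho : 'M[C]_d) : 'M[C]_d :=
  \sum_(i < k) kraus V i *m rho *m adjmx (kraus V i).

Definition stationary {C : numClosedFieldType} {d k : nat}
    (V : 'M[C]_(d * k, d)) (rho : 'M[C]_d) :=
  density rho /\ predual V rho = rho.

(* Uniqueness is among all states, not only among the positive definite ones. *)
Definition irreducible {C : numClosedFieldType} {d k : nat}
    (V : 'M[C]_(d * k, d)) :=
  exists rho : 'M[C]_d, [/\ stationary V rho, posdef rho &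
    forall sigma : 'M[C]_d, stationary V sigma -> sigma = rho].

(* The dimension k ^ n of the n-th tensor power of C^k, in the form
   k * (k * ... * 1), for which tens_dim k n.+1 is convertible to
   k * tens_dim k n. *)
Definition tens_dim (k n : nat) : nat := iter n (muln k) 1%N.

(* |i_1> (x) ... (x) |i_n> *)
Fixpoint ketn {C : numClosedFieldType} {k : nat} (n : nat) :
    ('I_n -> 'I_k) -> 'cV[C]_(tens_dim k n) :=
  if n is m.+1 then
    fun w => ket (w ord0) *t ketn (fun j : 'I_m => w (lift ord0 j))
  else fun=> 1%:M.

(* K_{i_n} ... K_{i_1} for the word i_1, ..., i_n *)
Definition kraus_word {C : numClosedFieldType} {d k : nat}
    (V : 'M[C]_(d * k, d)) (w : seq 'I_k) : 'M[C]_d :=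
  foldl (fun A i => kraus V i *m A) 1%:M w.

(* The cast is along d * 1 = d: in K_w *t |w> the ket is a map from C^1. See
   Vstep_expansion below. *)
Definition Vstep {C : numClosedFieldType} {d k : nat}
    (V : 'M[C]_(d * k, d)) (n : nat) : 'M[C]_(d * tens_dim k n, d) :=
  \sum_(w : n.-tuple 'I_k)
    castmx (erefl, muln1 d) (kraus_word V w *t ketn (tnth w)).

(* The partial trace over the first tensor factor. *)
Definition ptrace1 {C : numClosedFieldType} {d N : nat}
    (A : 'M[C]_(d * N)) : 'M[C]_N :=
  \matrix_(i, j) \sum_(a < d) A (mxtens_index (a, i)) (mxtens_index (a, j)).

Definition rho_out {C : numClosedFieldType} {d k : nat}
    (V : 'M[C]_(d * k, d)) (rho : 'M[C]_d) (n : nat) : 'M[C]_(tens_dim k n) :=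
  ptrace1 (Vstep V n *m rho *m adjmx (Vstep V n)).

Definition output_equivalent {C : numClosedFieldType} {d1 d2 k : nat}
    (V1 : 'M[C]_(d1 * k, d1)) (rho1 : 'M[C]_d1)
    (V2 : 'M[C]_(d2 * k, d2)) (rho2 : 'M[C]_d2) :=
  forall n : nat, rho_out V1 rho1 n = rho_out V2 rho2 n.

(* e^{i omega} *)
Definition expi {R : realType} (omega : R) : R[i] :=
  (cos omega +i* sin omega)%C.

Lemma kraus_expansion (C : numClosedFieldType) (d k : nat)
    (V : 'M[C]_(d * k, d)) (psi : 'cV[C]_d) :
  V *m psi = \sum_(i < k) (kraus V i *m psi) *t (ket i : 'cV_k).
Proof.
apply/colP => x; case: (mxtens_indexP x) => a i.
rewrite summxE (bigD1 i) //= big1 => [|j nij]; rewrite !mxE mxtens_indexK /=.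
  rewrite !eqxx mulr1 addr0; apply: eq_bigr => b _.
  by rewrite mxE [Ordinal _]ord1.
by rewrite eq_sym (negPf nij) mulr0.
Qed.

Lemma Vstep_expansion (C : numClosedFieldType) (d k n : nat)
    (V : 'M[C]_(d * k, d)) (psi : 'cV[C]_d) :
  Vstep V n *m psi =
    \sum_(w : n.-tuple 'I_k) (kraus_word V w *m psi) *t ketn (tnth w).
Proof.
rewrite mulmx_suml; apply: eq_bigr => w _; apply/colP => x.
case: (mxtens_indexP x) => a i.
have -> : (0 : 'I_(1 * 1)) = mxtens_index (ord0 : 'I_1, ord0 : 'I_1).
  exact: val_inj.
rewrite [RHS](tensmxE _ _ a i ord0 ord0) !mxE mulr_suml; apply: eq_bigr => b _.
have bE : cast_ord (esym (muln1 d)) b = mxtens_index (b, ord0 : 'I_1).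
  by apply: val_inj; rewrite /= muln1 addn0.
rewrite castmxE cast_ord_id bE tensmxE mulrAC.
by congr (_ * psi _ _ * _); exact: val_inj.
Qed.

(* Main.v *)
(* Consider the mixed transfer map [H X = sum_i K_1i^* X K_2i]. The traces
   tr (rho_out(n)^2) stay above [1 / d1^2], because rho_out(n) has rank at most
   [d1^2], whereas after factoring [rho_j = M_j M_j^*] the overlap of the two
   output states is a sum of squared matrix entries of [M_1^* H^n(E) M_2], for
   [E] ranging over the matrix units. So if the outputs agree, [H^n] does not
   tend to 0 and [H] has an eigenvector [X] with eigenvalue [|l| >= 1]. The
   equality case of Cauchy-Schwarz, weighted by the faithful state [rho_2],
   then forces [|l| = 1] and [X K_2i = l K_1i X]; irreducibility makes [X^* X]
   scalar, so [X] is a multiple of the unitary sought. *)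
Require Import Defs.
From HB Require Import structures.
From mathcomp Require Import all_boot all_order all_algebra.
From mathcomp Require Import complex mxtens ring.
From mathcomp Require Import boolp reals trigo.

Set Implicit Arguments.
Unset Strict Implicit.
Unset Printing Implicit Defensive.

Import Order.TTheory GRing.Theory Num.Theory.
Local Open Scope ring_scope.

(** * Adjoints and positive matrices *)

Section Adjoint.
Context {C : numClosedFieldType}.

Lemma adjmxE m n (A : 'M[C]_(m, n)) i j : adjmx A i j = (A j i)^*.
Proof. by rewrite !mxE. Qed.

Lemma adjmxK m n (A : 'M[C]_(m, n)) : adjmx (adjmx A) = A.
Proof. by apply/matrixP => i j; rewrite !adjmxE conjCK. Qed.

Lemma adjmxM m n p (A : 'M[C]_(m, n)) (B : 'M_(n, p)) :
  adjmx (A *m B) = adjmx B *m adjmx A.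
Proof. by rewrite /adjmx map_mxM trmx_mul. Qed.

Lemma adjmxD m n (A B : 'M[C]_(m, n)) : adjmx (A + B) = adjmx A + adjmx B.
Proof. by rewrite /adjmx map_mxD linearD. Qed.

Lemma adjmxB m n (A B : 'M[C]_(m, n)) : adjmx (A - B) = adjmx A - adjmx B.
Proof. by rewrite /adjmx map_mxB linearB. Qed.

Lemma adjmxZ m n a (A : 'M[C]_(m, n)) : adjmx (a *: A) = a^* *: adjmx A.
Proof. by rewrite /adjmx map_mxZ linearZ. Qed.

Lemma adjmx0 m n : adjmx (0 : 'M[C]_(m, n)) = 0.
Proof. by rewrite /adjmx map_mx0 trmx0. Qed.

Lemma adjmx_scalar n (a : C) : adjmx (a%:M : 'M_n) = a^*%:M.
Proof. by rewrite /adjmx map_scalar_mx tr_scalar_mx. Qed.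

Lemma mxtrace_adj n (A : 'M[C]_n) : \tr (adjmx A) = (\tr A)^*.
Proof. by rewrite /adjmx mxtrace_tr trace_map_mx. Qed.

Lemma mxtrace_mul_adj m n (A : 'M[C]_(m, n)) :
  \tr (A *m adjmx A) = \sum_i \sum_j `|A i j| ^+ 2.
Proof.
apply: eq_bigr => i _; rewrite mxE; apply: eq_bigr => j _.
by rewrite adjmxE normCK.
Qed.

Lemma mxtrace_mul_adj_ge0 m n (A : 'M[C]_(m, n)) : 0 <= \tr (A *m adjmx A).
Proof.
by rewrite mxtrace_mul_adj; do 2!(apply: sumr_ge0 => ? _); rewrite exprn_ge0.
Qed.

Lemma mxtrace_mul_adj_eq0 m n (A : 'M[C]_(m, n)) :
  \tr (A *m adjmx A) = 0 -> A = 0.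
Proof.
rewrite mxtrace_mul_adj => A0; apply/matrixP => i j; rewrite mxE.
have le0 i' j' : 0 <= `|A i' j'| ^+ 2 by rewrite exprn_ge0.
move/eqP: A0; rewrite psumr_eq0 => [|i' _]; last exact: sumr_ge0.
move/allP/(_ i); rewrite mem_index_enum => /(_ isT)/=.
rewrite psumr_eq0 // => /allP/(_ j); rewrite mem_index_enum => /(_ isT)/=.
by rewrite expf_eq0 normr_eq0 => /eqP.
Qed.

Lemma psd_mul_adj m n (A : 'M[C]_(m, n)) : psd (A *m adjmx A).
Proof.
move=> v; have := mxtrace_mul_adj_ge0 (adjmx v *m A).
by rewrite adjmxM adjmxK -!mulmxA mulmxA [\tr _]big_ord1 mulmxA.
Qed.


(* Polarization in [u + w] and [u + 'i w]. *)
Lemma quadratic_form_eq0 n (B : 'M[C]_n) :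
  (forall v : 'cV_n, (adjmx v *m B *m v) 0 0 = 0) -> B = 0.
Proof.
move=> B0; apply/matrixP => i j; rewrite [RHS]mxE.
have pol (u w : 'cV[C]_n) c :
    c * (adjmx u *m B *m w) 0 0 + c^* * (adjmx w *m B *m u) 0 0 = 0.
  have := B0 (u + c *: w).
  rewrite adjmxD adjmxZ !mulmxDl !mulmxDr -!scalemxAl -!scalemxAr.
  have addE (x y : 'M[C]_1) : (x + y) 0 0 = x 0 0 + y 0 0 by rewrite mxE.
  have scaleE a (x : 'M[C]_1) : (a *: x) 0 0 = a * x 0 0 by rewrite mxE.
  by rewrite !(addE, scaleE) !B0 !mulr0 add0r addr0 addrC.
have ij k l : (adjmx (delta_mx k 0 : 'cV[C]_n) *m B *m
    (delta_mx l 0 : 'cV_n)) 0 0 = B k l.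
  have -> : adjmx (delta_mx k 0 : 'cV[C]_n) = delta_mx 0 k.
    by apply/matrixP => a b; rewrite !mxE conjC_nat andbC.
  by rewrite -rowE -colE !mxE.
have := pol (delta_mx i 0) (delta_mx j 0) 1.
have := pol (delta_mx i 0) (delta_mx j 0) 'i.
rewrite !ij conjCi rmorph1 !mul1r mulNr -mulrBr => /eqP.
rewrite mulf_eq0 (negPf (neq0Ci _)) subr_eq0 => /eqP -> /eqP.
by rewrite -mulr2n mulrn_eq0 => /eqP.
Qed.

(** The values of the form are real, so the form of [adjmx A - A], each value of which is a
    conjugate minus the number itself, vanishes identically. *)
Lemma psd_hermitian n (A : 'M[C]_n) : psd A -> adjmx A = A.
Proof.
move=> Apsd; apply/eqP; rewrite -subr_eq0; apply/eqP/quadratic_form_eq0 => v.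
have -> : adjmx v *m (adjmx A - A) *m v =
    adjmx (adjmx v *m A *m v) - adjmx v *m A *m v.
  by rewrite !adjmxM adjmxK mulmxBr mulmxBl !mulmxA.
set q := _ *m v; have q_ge0 : 0 <= q 0 0 := Apsd v.
have -> : (adjmx q - q) 0 0 = (q 0 0)^* - q 0 0 by rewrite !mxE.
by rewrite (CrealP (ger0_real q_ge0)) subrr.
Qed.

Lemma posdef_unit n (A : 'M[C]_n) : posdef A -> A \in unitmx.
Proof.
move=> Apos; rewrite unitmxE unitfE; apply/negP => /det0P[v v0 vA0].
have /Apos : adjmx v != 0.
  by apply: contra_neq v0 => v0; rewrite -[v]adjmxK v0 adjmx0.
by rewrite adjmxK vA0 mul0mx mxE ltxx.
Qed.

(** By the spectral theorem [A = P^* D P]; take [M = P^* sqrt D]. *)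
Lemma psd_factor n (A : 'M[C]_n) : psd A -> exists M : 'M_n, A = M *m adjmx M.
Proof.
move=> Apsd; pose P := spectralmx A; pose D := spectral_diag A.
have adjE p q (B : 'M[C]_(p, q)) : map_mx Num.conj B^T = adjmx B.
  by rewrite /adjmx map_trmx.
have Pu : P *m adjmx P = 1%:M.
  by rewrite -adjE; apply/unitarymxP/spectral_unitarymx.
have PuV : adjmx P *m P = 1%:M by apply: mulmx1C.
have DE : A = adjmx P *m diag_mx D *m P.
  have /orthomx_spectralP : A \is normalmx.
    by apply/normalmxP; rewrite adjE psd_hermitian.
  by rewrite invmx_unitary ?spectral_unitarymx // adjE.
(* The eigenvalue [D 0 j] is the value of the form at the eigenvector [adjmx (row j P)]. *)
have D_ge0 j : 0 <= D 0 j.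
  have := Apsd (adjmx (row j P)); rewrite adjmxK DE.
  have -> : row j P *m (adjmx P *m diag_mx D *m P) *m adjmx (row j P) =
            row j (diag_mx D) *m (P *m adjmx (row j P)).
    by rewrite -!row_mul !mulmxA Pu mul1mx.
  have -> : P *m adjmx (row j P) = delta_mx j 0.
    have -> : delta_mx j 0 = col j 1%:M :> 'cV[C]_n by rewrite colE mul1mx.
    rewrite -Pu; apply/matrixP => a b; rewrite !mxE.
    by apply: eq_bigr => c _; rewrite !mxE.
  by rewrite -colE !mxE eqxx.
pose M := adjmx P *m diag_mx (map_mx sqrtC D); exists M.
rewrite {1}DE adjmxM adjmxK /M !mulmxA; congr (_ *m _).
rewrite -!mulmxA; congr (_ *m _).
have -> : adjmx (diag_mx (map_mx sqrtC D)) = diag_mx (map_mx sqrtC D).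
  apply/matrixP => i j; rewrite !mxE eq_sym rmorphMn /=.
  case: eqP => [->|] //=; by rewrite conj_Creal // ger0_real ?sqrtC_ge0.
rewrite mulmx_diag; congr diag_mx; apply/rowP => j.
by rewrite !mxE -expr2 sqrtCK.
Qed.

Lemma posdef_factor n (A : 'M[C]_n) :
  posdef A -> exists2 M : 'M_n, A = M *m adjmx M & M \in unitmx.
Proof.
move=> Apos; have /psd_factor[M AE] : psd A.
  move=> v; have [->|/Apos/ltW//] := eqVneq v 0.
  by rewrite mulmx0 mxE.
exists M => //; have := posdef_unit Apos.
by rewrite AE unitmx_mul => /andP[].
Qed.

End Adjoint.

(** * Geometric decay of matrix powers *)

Section Decay.
Context {C : numClosedFieldType}.

(** That is, [u n = O(r^n)]; the instance [n = 0] already forces [c] to be nonnegative. *)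
Definition decays (r : C) (u : nat -> C) :=
  exists c : C, forall n, `|u n| <= c * r ^+ n.

Lemma decays_ext r u v : u =1 v -> decays r u -> decays r v.
Proof. by move=> uv [c cP]; exists c => n; rewrite -uv. Qed.

Lemma decays0 r : decays r (fun=> 0).
Proof. by exists 0 => n; rewrite normr0 mul0r. Qed.

Lemma decaysD r u v : decays r u -> decays r v -> decays r (fun n => u n + v n).
Proof.
move=> [c cP] [c' c'P]; exists (c + c') => n; rewrite mulrDl.
by apply: le_trans (ler_normD _ _) _; apply: lerD.
Qed.

Lemma decaysZ r a u : decays r u -> decays r (fun n => a * u n).
Proof.
move=> [c cP]; exists (`|a| * c) => n; rewrite normrM -mulrA.
exact: ler_wpM2l.
Qed.

Lemma decays_sum r (I : Type) (s : seq I) (u : I -> nat -> C) :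
  (forall i, decays r (u i)) -> decays r (fun n => \sum_(i <- s) u i n).
Proof.
move=> ui; elim: s => [|i s IH].
  by apply: decays_ext (decays0 r) => n; rewrite big_nil.
by apply: decays_ext (decaysD (ui i) IH) => n; rewrite big_cons.
Qed.

Lemma decays_sqr r u : 0 <= r <= 1 -> decays r u -> decays r (fun n => `|u n| ^+ 2).
Proof.
move=> /andP[r0 r1] [c cP].
have c0 : 0 <= c.
  by have := cP 0%N; rewrite expr0 mulr1; apply: le_trans.
exists (c ^+ 2) => n; rewrite normrX normr_id.
apply: le_trans (_ : (c * r ^+ n) ^+ 2 <= _).
  by apply: lerXn2r => //; rewrite nnegrE mulr_ge0 // exprn_ge0.
rewrite exprMn ler_wpM2l ?exprn_ge0 // expr2 ler_piMl ?exprn_ge0 //.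
exact: exprn_ile1.
Qed.

Lemma decays_recurrence r z u : 0 < r -> `|z| < r ->
  decays r (fun n => u n.+1 - z * u n) -> decays r u.
Proof.
move=> r0 zr [c cP].
have c0 : 0 <= c.
  by have := cP 0%N; rewrite expr0 mulr1; apply: le_trans.
have d0 : 0 < r - `|z| by rewrite subr_gt0.
(* The term [c / (r - |z|)] solves [|z| b + c = r b], which carries the induction; the term [|u 0|]
   starts it. *)
pose b := `|u 0%N| + c / (r - `|z|); exists b.
have bc : `|z| * b + c <= r * b.
  rewrite -lerBrDl -mulrBl /b mulrDr [_ * (c / _)]mulrC divfK ?gt_eqF //.
  by rewrite lerDr mulr_ge0 // ltW.
elim=> [|n IH].
  by rewrite expr0 mulr1 /b lerDl divr_ge0 // ltW.
have -> : u n.+1 = (u n.+1 - z * u n) + z * u n by rewrite subrK.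
apply: le_trans (ler_normD _ _) _.
apply: le_trans (_ : c * r ^+ n + `|z| * (b * r ^+ n) <= _).
  by apply: lerD => //; rewrite normrM ler_wpM2l.
rewrite mulrA -mulrDl exprS mulrA [b * r]mulrC addrC.
by rewrite ler_wpM2r // exprn_ge0 // ltW.
Qed.

Lemma uniform_norm_bound (s : seq C) : (forall z, z \in s -> `|z| < 1) ->
  exists r, [/\ 0 < r, r < 1 & forall z, z \in s -> `|z| < r].
Proof.
elim: s => [_|z s IH sP].
  exists 2^-1; rewrite invr_gt0 ltr0n invf_lt1 ?ltr1n //.
have [|r [r0 r1 rP]] := IH; first by move=> w ws; rewrite sP // inE ws orbT.
have z1 : `|z| < 1 by rewrite sP ?inE ?eqxx.
(* A substitute for the maximum of [r] and [|z|]: at least [r], strictly above [|z|], still below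
   1. *)
exists (1 - (1 - r) * (1 - `|z|)); split.
- have -> : 1 - (1 - r) * (1 - `|z|) = r + (1 - r) * `|z| by ring.
  by rewrite ltr_pwDl // mulr_ge0 // subr_ge0 ltW.
- by rewrite gtrBl mulr_gt0 // subr_gt0.
- move=> w; rewrite inE => /predU1P[->|/rP wr].
    rewrite -subr_gt0.
    have -> : 1 - (1 - r) * (1 - `|z|) - `|z| = r * (1 - `|z|) by ring.
    by rewrite mulr_gt0 // subr_gt0.
  apply: lt_le_trans wr _; rewrite -subr_ge0.
  have -> : 1 - (1 - r) * (1 - `|z|) - r = (1 - r) * `|z| by ring.
  by rewrite mulr_ge0 // subr_ge0 ltW.
Qed.

(** Roots are peeled off one at a time: [v (T - z)] is annihilated by the remaining factors, and its
    orbit is [v T^(n+1) - z v T^n], so [decays_recurrence] applies. Repeated roots cost nothing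
    because [|z| < r] is strict. *)
Lemma decays_power_annihilated N (T : 'M[C]_N.+1) r (s : seq C) :
    0 < r -> (forall z, z \in s -> `|z| < r) ->
  forall v : 'rV_N.+1, v *m horner_mx T (\prod_(z <- s) ('X - z%:P)) = 0 ->
  forall j, decays r (fun n => (v *m T ^+ n) 0 j).
Proof.
move=> r0; elim: s => [_ v|z s IH sr v].
  rewrite big_nil rmorph1 mulmx1 => -> j.
  by apply: decays_ext (decays0 r) => n; rewrite mul0mx mxE.
rewrite big_cons rmorphM /= rmorphB /= horner_mx_X horner_mx_C => vT j.
apply: (@decays_recurrence r z) => //; first by rewrite sr ?inE ?eqxx.
have sr' w : w \in s -> `|w| < r by move=> ws; rewrite sr // inE ws orbT.
rewrite -[_ * _]/(_ *m _) mulmxA in vT.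
apply: decays_ext (IH sr' _ vT j) => n.
rewrite mulmxBr mulmxBl -!mulmxA -[T *m _]/(T * _) -exprS mul_scalar_mx.
by rewrite -scalemxAr; move: (v *m _) (v *m _) => x y; rewrite !mxE.
Qed.

(** The characteristic polynomial splits into linear factors and, by Cayley-Hamilton, annihilates
    [T]; any [r < 1] above the moduli of its roots serves as rate. *)
Lemma decays_power N (T : 'M[C]_N) : (forall z, eigenvalue T z -> `|z| < 1) ->
  exists r, [/\ 0 < r, r < 1 & forall (v : 'rV_N) j,
    decays r (fun n => (iter n (mulmx^~ T) v) 0 j)].
Proof.
case: N T => [|N] T ev.
  by have [|r [r0 r1 _]] := @uniform_norm_bound [::]; [|exists r; split=> // v []].
have [s sE] := closed_field_poly_normal (char_poly T).
rewrite (monicP (char_poly_monic T)) scale1r in sE.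
have [z zs|r [r0 r1 sr]] := @uniform_norm_bound s.
  by rewrite ev // eigenvalue_root_char sE root_prod_XsubC.
exists r; split=> // v j.
apply: decays_ext (decays_power_annihilated (T := T) r0 sr (v := v) _ j) => [n|].
  congr (fun_of_matrix _ 0 j); elim: n => [|n IH]; first by rewrite expr0 mulmx1.
  by rewrite /= -IH exprSr mulmxA.
by rewrite -sE Cayley_Hamilton mulmx0.
Qed.

End Decay.

Lemma decays_not_bounded_below (R : realType) (r eps : R[i]) (u : nat -> R[i]) :
  0 < r -> r < 1 -> 0 < eps -> (forall n, eps <= `|u n|) -> ~ decays r u.
Proof.
move=> r0 r1 e0 eu [c cP].
(* A Bernoulli-type estimate: geometric decay beats [1 / n], so that [eps (1 - r) n <= c] would hold
   for every [n]. *)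
have geo n : r ^+ n * (1 + n%:R * (1 - r)) <= 1.
  elim: n => [|n IH]; first by rewrite mul0r addr0 mulr1 expr0.
  apply: le_trans IH; rewrite exprSr -mulrA ler_wpM2l ?exprn_ge0 ?(ltW r0) //.
  rewrite -subr_ge0 -[n.+1]addn1 natrD.
  have -> : 1 + n%:R * (1 - r) - r * (1 + (n%:R + 1) * (1 - r)) =
    (n%:R + 1) * (1 - r) ^+ 2 by ring.
  by rewrite mulr_ge0 ?addr_ge0 ?ler01 ?ler0n ?exprn_ge0 ?subr_ge0 ?(ltW r1).
have bnd n : eps * (1 - r) * n%:R <= c.
  have s0 : 0 < 1 + n%:R * (1 - r).
    by rewrite ltr_pwDl // mulr_ge0 // subr_ge0 ltW.
  have c0 : 0 <= c by have := cP 0%N; rewrite expr0 mulr1; apply: le_trans.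
  have /(ler_wpM2r (ltW s0)) := le_trans (eu n) (cP n).
  rewrite -[X in _ <= X]mulrA => /le_trans/(_ (ler_wpM2l c0 (geo n))).
  rewrite mulr1; apply: le_trans.
  by rewrite -mulrA ler_wpM2l ?(ltW e0) // mulrC lerDr ler01.
have d0 : 0 < eps * (1 - r) by rewrite mulr_gt0 // subr_gt0.
have c0 : 0 <= c by have := bnd 0%N; rewrite mulr0.
(* The Archimedean property is used in [R], so the bound on [n], a real element of [R[i]], is
   brought down to [R]. *)
pose x := complex.Re (c / (eps * (1 - r))).
have xE : x%:C%C = c / (eps * (1 - r)).
  by rewrite /x RRe_real // ger0_real // divr_ge0 // ltW.
have x0 : 0 <= x by rewrite -ler0c xE divr_ge0 // ltW.
have := bnd (Num.bound x); rewrite mulrC -ler_pdivlMr // -xE.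
have -> : (Num.bound x)%:R = (Num.bound x)%:R%:C%C :> R[i] by rewrite rmorph_nat.
by rewrite lecR leNgt archi_boundP.
Qed.

(** * Intertwiners of irreducible isometries *)

Section Intertwiner.
Context {C : numClosedFieldType}.

Lemma sum_mxtens_index (V : nmodType) m n (F : 'I_(m * n) -> V) :
  \sum_x F x = \sum_i \sum_j F (mxtens_index (i, j)).
Proof.
rewrite pair_big (reindex (@mxtens_index m n)) /=.
  by apply: eq_bigr => -[i j].
by exists (@mxtens_unindex m n) => x _; rewrite ?mxtens_indexK ?mxtens_unindexK.
Qed.

(** The map [H] of the overview; for [V1 = V2] it is the channel itself, in the Heisenberg
    picture. *)
Definition transfer d1 d2 k (V1 : 'M[C]_(d1 * k, d1)) (V2 : 'M[C]_(d2 * k, d2))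
    (X : 'M[C]_(d1, d2)) : 'M[C]_(d1, d2) :=
  \sum_(i < k) adjmx (kraus V1 i) *m X *m kraus V2 i.

Lemma tensmx1_mulE d1 d2 k (W : 'M[C]_(d1, d2)) (V : 'M[C]_(d2 * k, d2)) a i b :
  ((W *t (1%:M : 'M_k)) *m V) (mxtens_index (a, i)) b = (W *m kraus V i) a b.
Proof.
rewrite !mxE sum_mxtens_index; apply: eq_bigr => c _.
rewrite (bigD1 i) //= big1 ?addr0 => [|j ji]; rewrite tensmxE !mxE.
  by rewrite eqxx mulr1.
by rewrite eq_sym (negPf ji) mulr0 mul0r.
Qed.

Lemma mulmx_krausE d1 d2 k (W : 'M[C]_(d1, d2)) (V : 'M[C]_(d1 * k, d1)) a i b :
  (V *m W) (mxtens_index (a, i)) b = (kraus V i *m W) a b.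
Proof. by rewrite !mxE; apply: eq_bigr => c _; rewrite mxE. Qed.

Lemma isometric_transfer1 d k (V : 'M[C]_(d * k, d)) :
  isometric V -> transfer V V 1%:M = 1%:M.
Proof.
move=> VV; apply/matrixP => a b; rewrite -[in RHS]VV summxE [RHS]mxE.
rewrite sum_mxtens_index exchange_big; apply: eq_bigr => i _.
by rewrite mulmx1 mxE; apply: eq_bigr => c _; rewrite !mxE.
Qed.

Lemma irreducible_unique d k (V : 'M[C]_(d * k, d)) rho sigma :
  irreducible V -> stationary V rho -> stationary V sigma -> sigma = rho.
Proof. by case=> tau [_ _ tauP] /tauP -> /tauP ->. Qed.

Lemma irreducible_posdef d k (V : 'M[C]_(d * k, d)) rho :
  irreducible V -> stationary V rho -> posdef rho.
Proof. by case=> tau [_ tau_pos tauP] /tauP ->. Qed.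

(** With [rho = M M^*], this trace is the squared Hilbert-Schmidt norm of [X M], and [M] is
    invertible. *)
Lemma mxtrace_conj_gt0 d1 d2 (rho : 'M[C]_d2) (X : 'M[C]_(d1, d2)) :
  posdef rho -> X != 0 -> 0 < \tr (X *m rho *m adjmx X).
Proof.
move=> /posdef_factor[M -> Mu] X0.
have -> : X *m (M *m adjmx M) *m adjmx X = (X *m M) *m adjmx (X *m M).
  by rewrite adjmxM !mulmxA.
rewrite lt_def mxtrace_mul_adj_ge0 andbT; apply: contra_neq X0.
by move=> /mxtrace_mul_adj_eq0 /(congr1 (mulmx^~ (invmx M))); rewrite mulmxK // mul0mx.
Qed.

Section Pair.
Context {d1 d2 k : nat}.
Context (V1 : 'M[C]_(d1 * k, d1)) (V2 : 'M[C]_(d2 * k, d2)).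
Context (rho2 : 'M[C]_d2).
Hypotheses (isoV1 : isometric V1) (rho2_pos : posdef rho2).
Hypothesis ss2 : stationary V2 rho2.

(* Equality in Cauchy-Schwarz: the defects [X K_2i - l K_1i X], weighted by the
   faithful state [rho2], have total squared norm
   [(1 - |l|^2) tr (X rho2 X^* )]. *)
Lemma eigenvector_intertwines (X : 'M[C]_(d1, d2)) (l : C) :
    X != 0 -> transfer V1 V2 X = l *: X -> 1 <= `|l| ->
  `|l| = 1 /\ forall i, X *m kraus V2 i = l *: (kraus V1 i *m X).
Proof.
move=> X0 Xl l1; pose D i := X *m kraus V2 i - l *: (kraus V1 i *m X).
have t_gt0 := mxtrace_conj_gt0 rho2_pos X0.
set t := \tr _ in t_gt0.
(* [E1] to [E4] are the terms of the expanded squared norm of the defects: [E1] comes from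
   stationarity of [rho2], [E2] from unitality of the first channel, [E3] and its conjugate [E4]
   from the eigenvector equation. *)
have E1 : \sum_i \tr (X *m kraus V2 i *m rho2 *m adjmx (X *m kraus V2 i)) = t.
  rewrite /t -{2}(proj2 ss2) /predual mulmx_sumr mulmx_suml raddf_sum /=.
  by apply: eq_bigr => i _; rewrite adjmxM !mulmxA.
have E2 : \sum_i \tr (kraus V1 i *m X *m rho2 *m adjmx (kraus V1 i *m X)) = t.
  have -> : t = \tr (transfer V1 V1 1%:M *m (X *m rho2 *m adjmx X)).
    by rewrite isometric_transfer1 // mul1mx.
  rewrite /transfer mulmx_suml raddf_sum /=; apply: eq_bigr => i _.
  by rewrite adjmxM mulmx1 mulmxA mxtrace_mulC !mulmxA.
have rho2_adj : adjmx rho2 = rho2 by apply: psd_hermitian; case: ss2 => -[].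
have E3 : \sum_i \tr (X *m kraus V2 i *m rho2 *m adjmx (kraus V1 i *m X)) = l * t.
  have -> : l * t = \tr (transfer V1 V2 X *m (rho2 *m adjmx X)).
    by rewrite Xl -scalemxAl mxtraceZ mulmxA.
  rewrite /transfer mulmx_suml raddf_sum /=; apply: eq_bigr => i _.
  by rewrite adjmxM mulmxA mxtrace_mulC !mulmxA.
have E4 : \sum_i \tr (kraus V1 i *m X *m rho2 *m adjmx (X *m kraus V2 i)) = l^* * t.
  rewrite -[t](CrealP (gtr0_real t_gt0)) -rmorphM -E3 rmorph_sum.
  apply: eq_bigr => i _.
  rewrite /=.
  by rewrite -mxtrace_adj !(adjmxM, adjmxK) rho2_adj !mulmxA.
have DE : \sum_i \tr (D i *m rho2 *m adjmx (D i)) = (1 - `|l| ^+ 2) * t.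
  under eq_bigr => i _.
    rewrite /D adjmxB adjmxZ mulmxBl mulmxBl !mulmxBr -!scalemxAl -!scalemxAr.
    rewrite !linearB !linearZ /=.
  over.
  rewrite !sumrB -!mulr_sumr E1 E2 E3 E4 normCK; ring.
have D_ge0 i : 0 <= \tr (D i *m rho2 *m adjmx (D i)).
  have [->|Di0] := eqVneq (D i) 0; first by rewrite !mul0mx mxtrace0.
  exact/ltW/mxtrace_conj_gt0.
have l_le1 : `|l| <= 1.
  have : 0 <= (1 - `|l| ^+ 2) * t by rewrite -DE sumr_ge0.
  by rewrite pmulr_lge0 // subr_ge0 expr_le1.
have {l1 l_le1} l1 : `|l| = 1 by apply/le_anti; rewrite l1 l_le1.
split=> // i; apply/eqP; rewrite -subr_eq0 -[_ - _]/(D i); apply/negP => /negP Di0.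
move/eqP: DE; rewrite l1 expr1n subrr mul0r psumr_eq0 // => /allP/(_ i).
by rewrite mem_index_enum => /(_ isT); rewrite gt_eqF // mxtrace_conj_gt0.
Qed.

(** The phases cancel in [K S K^*], so [S = X rho2 X^*] is a positive fixed point of the first
    predual; once normalized it is a stationary state, hence [rho1]. *)
Lemma intertwiner_stationary (X : 'M[C]_(d1, d2)) (l : C) (rho1 : 'M[C]_d1) :
    irreducible V1 -> stationary V1 rho1 ->
    X != 0 -> `|l| = 1 -> (forall i, X *m kraus V2 i = l *: (kraus V1 i *m X)) ->
  X *m rho2 *m adjmx X = \tr (X *m rho2 *m adjmx X) *: rho1.
Proof.
move=> irr1 ss1 X0 l1 XK; set S := X *m rho2 *m adjmx X.
have t_gt0 : 0 < \tr S by apply: mxtrace_conj_gt0.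
have [M rho2E _] := posdef_factor rho2_pos.
have SE : S = (X *m M) *m adjmx (X *m M).
  by rewrite /S rho2E adjmxM !mulmxA.
have predS : predual V1 S = S.
  rewrite /S -{2}(proj2 ss2) /predual mulmx_sumr mulmx_suml.
  apply: eq_bigr => i _.
  have -> : X *m (kraus V2 i *m rho2 *m adjmx (kraus V2 i)) *m adjmx X =
      (X *m kraus V2 i) *m rho2 *m adjmx (X *m kraus V2 i).
    by rewrite adjmxM !mulmxA.
  rewrite XK adjmxZ -!scalemxAl -scalemxAr scalerA -normCK l1 expr1n scale1r.
  by rewrite adjmxM !mulmxA.
have ssS : stationary V1 ((\tr S)^-1 *: S).
  split; [split|].
  - move=> v; rewrite -scalemxAr -scalemxAl mxE mulr_ge0 ?invr_ge0 ?(ltW t_gt0) //.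
    by rewrite SE; apply: psd_mul_adj.
  - by rewrite mxtraceZ mulVf ?gt_eqF.
  - rewrite -{4}predS /predual scaler_sumr; apply: eq_bigr => i _.
    by rewrite -scalemxAr -scalemxAl.
by rewrite -(irreducible_unique irr1 ss1 ssS) scalerA divff ?scale1r ?gt_eqF.
Qed.

End Pair.

(* [Y = Q - m], for an eigenvalue [m] of [Q], intertwines [V] with itself, so
   unless it vanishes [Y rho Y^*] is a nonzero multiple of the invertible
   [rho], although [Y] is singular. *)
Lemma irreducible_fixed_scalar d k (V : 'M[C]_(d * k, d)) (Q : 'M[C]_d) :
    isometric V -> irreducible V -> transfer V V Q = Q -> exists m, Q = m%:M.
Proof.
move=> isoV irrV fixQ.
have [d0|d_gt0] := posnP d.
  by exists 0; apply/matrixP => i; have := ltn_ord i; rewrite {2}d0.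
have [rho [ss rho_pos _]] := irrV.
have [m mQ] := eigenvalue_closed Q d_gt0; exists m.
apply/eqP; rewrite -subr_eq0; set Y := Q - _; apply/negP => /negP Y0.
have fixY : transfer V V Y = 1 *: Y.
  transitivity (transfer V V Q - m *: transfer V V 1%:M); last first.
    by rewrite isometric_transfer1 // fixQ scalemx1 scale1r.
  rewrite /transfer scaler_sumr -sumrB; apply: eq_bigr => i _.
  by rewrite mulmxBr mulmxBl mulmx1 mul_mx_scalar -scalemxAl.
have [|_ YK] := eigenvector_intertwines isoV rho_pos ss Y0 fixY.
  by rewrite normr1.
have := intertwiner_stationary rho_pos ss irrV ss Y0 (normr1 _) YK.
set t := \tr _ => tE.
have : t *: rho \in unitmx.
  rewrite unitmxZ ?posdef_unit // unitfE gt_eqF //.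
  exact: mxtrace_conj_gt0.
rewrite -tE !unitmx_mul => /andP[/andP[Yu _] _].
have [v vQ v0] := eigenvalueP mQ.
have : v *m Y = 0 by rewrite mulmxBr vQ mul_mx_scalar subrr.
move/(congr1 (mulmx^~ (invmx Y))); rewrite mulmxK // mul0mx => v0'.
by rewrite v0' eqxx in v0.
Qed.

(** The unitary is [X / sqrt m], where [X^* X = m]; the number [m] is also the trace of
    [X rho2 X^*], hence positive. *)
Lemma unitary_of_eigenvector d1 d2 k
    (V1 : 'M[C]_(d1 * k, d1)) (V2 : 'M[C]_(d2 * k, d2)) rho1 rho2
    (X : 'M[C]_(d1, d2)) (l : C) :
    isometric V1 -> isometric V2 -> irreducible V1 -> irreducible V2 ->
    stationary V1 rho1 -> stationary V2 rho2 ->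
    X != 0 -> transfer V1 V2 X = l *: X -> 1 <= `|l| ->
  `|l| = 1 /\ exists W : 'M[C]_(d1, d2), [/\ unitary W,
    forall i, kraus V2 i = l *: (adjmx W *m kraus V1 i *m W) &
    rho2 = adjmx W *m rho1 *m W].
Proof.
move=> iso1 iso2 irr1 irr2 ss1 ss2 X0 Xl l_ge1.
have rho1_pos := irreducible_posdef irr1 ss1.
have rho2_pos := irreducible_posdef irr2 ss2.
have [l1 XK] := eigenvector_intertwines iso1 rho2_pos ss2 X0 Xl l_ge1.
split=> //.
(* Intertwining turns [K_2i^* X^* X K_2i] into [X^* K_1i^* K_1i X], and the sum over [i] collapses
   to [X^* X] since [V1] is isometric. *)
have [m XX] : exists m, adjmx X *m X = m%:M.
  apply: (irreducible_fixed_scalar iso2 irr2).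
  transitivity (adjmx X *m transfer V1 V1 1%:M *m X); last first.
    by rewrite isometric_transfer1 // mulmx1.
  rewrite /transfer mulmx_sumr mulmx_suml; apply: eq_bigr => i _.
  rewrite !mulmxA -adjmxM -mulmxA XK adjmxZ adjmxM -!scalemxAl -!scalemxAr scalerA.
  by rewrite -normCKC l1 expr1n scale1r mulmx1 !mulmxA.
have XrX := intertwiner_stationary rho2_pos ss2 irr1 ss1 X0 l1 XK.
have tE : \tr (X *m rho2 *m adjmx X) = m.
  rewrite -mulmxA mxtrace_mulC -mulmxA XX mul_mx_scalar mxtraceZ.
  by rewrite (proj2 (proj1 ss2)) mulr1.
have m_gt0 : 0 < m by rewrite -tE mxtrace_conj_gt0.
rewrite tE in XrX.
pose W := (sqrtC m)^-1 *: X.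
have s2 : (sqrtC m)^-1^* * (sqrtC m)^-1 = m^-1.
  rewrite conj_Creal ?rpredV ?ger0_real ?sqrtC_ge0 ?(ltW m_gt0) //.
  by rewrite -expr2 exprVn sqrtCK.
have WW : adjmx W *m W = 1%:M.
  rewrite /W adjmxZ -scalemxAl -scalemxAr scalerA s2 XX scale_scalar_mx.
  by rewrite mulVf ?gt_eqF.
have WrW : W *m rho2 *m adjmx W = rho1.
  rewrite /W adjmxZ -!scalemxAl -scalemxAr scalerA mulrC s2 XrX scalerA.
  by rewrite mulVf ?scale1r ?gt_eqF.
exists W; split; first split=> //.
(* As [d1 = d2] is not known, [W W^* = 1] does not follow from [W^* W = 1]; it is obtained by
   cancelling the invertible [rho1]. *)
- have : W *m adjmx W *m rho1 = rho1.
    by rewrite -{1}WrW !mulmxA -[W *m _ *m W]mulmxA WW mulmx1 WrW.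
  move/(congr1 (mulmx^~ (invmx rho1))).
  by rewrite mulmxK ?mulmxV ?posdef_unit.
- move=> i; rewrite -mulmxA.
  have -> : l *: (adjmx W *m (kraus V1 i *m W)) = adjmx W *m (W *m kraus V2 i).
    by rewrite /W -scalemxAl XK scalerA mulrC -scalerA !scalemxAr.
  by rewrite mulmxA WW mul1mx.
- by rewrite -WrW !mulmxA WW mul1mx -mulmxA WW mulmx1.
Qed.

End Intertwiner.

(** * Output states *)

Section Output.
Context {C : numClosedFieldType}.

Fact transfer_is_linear d1 d2 k (V1 : 'M[C]_(d1 * k, d1)) (V2 : 'M[C]_(d2 * k, d2)) :
  linear (transfer V1 V2).
Proof.
move=> a X Y; rewrite /transfer scaler_sumr -big_split; apply: eq_bigr => i _ /=.
by rewrite mulmxDr mulmxDl -scalemxAr -scalemxAl.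
Qed.

HB.instance Definition _ d1 d2 k (V1 : 'M[C]_(d1 * k, d1)) (V2 : 'M[C]_(d2 * k, d2)) :=
  GRing.isLinear.Build C _ _ _ (transfer V1 V2) (transfer_is_linear V1 V2).

Lemma eq_ketn k n (f g : 'I_n -> 'I_k) :
  f =1 g -> ketn f = ketn g :> 'cV[C]_(tens_dim k n).
Proof.
elim: n f g => //= n IH f g fg; rewrite fg.
by rewrite (IH _ (fun j => g (lift ord0 j))).
Qed.

Lemma kraus_word_cons d k (V : 'M[C]_(d * k, d)) i w :
  kraus_word V (i :: w) = kraus_word V w *m kraus V i.
Proof.
rewrite /kraus_word /= mulmx1 -[kraus V i in LHS]mul1mx.
elim: w (1%:M : 'M[C]_d) => //= j w IH A.
by rewrite mulmxA IH.
Qed.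

(** [Vstep V n] is viewed as a single step with a larger output space, so that [kraus] and
    [transfer] apply to it. *)
Lemma kraus_VstepE d k n (V : 'M[C]_(d * k, d)) x :
  kraus (Vstep V n) x = \sum_(w : n.-tuple 'I_k) ketn (tnth w) x 0 *: kraus_word V w.
Proof.
apply/matrixP => a b; rewrite mxE !summxE; apply: eq_bigr => w _.
have bE : cast_ord (esym (muln1 d)) b = mxtens_index (b, ord0 : 'I_1).
  by apply: val_inj; rewrite /= muln1 addn0.
rewrite castmxE cast_ord_id bE tensmxE mxE mulrC.
by congr (ketn _ _ _ * _); exact: val_inj.
Qed.

Lemma kraus_Vstep0 d k (V : 'M[C]_(d * k, d)) x : kraus (Vstep V 0) x = 1%:M.
Proof.
rewrite kraus_VstepE (bigD1 [tuple]) //= big1 ?addr0.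
  by rewrite ord1 mxE scale1r.
by move=> w; rewrite tuple0.
Qed.

(** The first letter of a word acts first, so it is split off on the right. *)
Lemma kraus_VstepS d k n (V : 'M[C]_(d * k, d)) (i : 'I_k) (y : 'I_(tens_dim k n)) :
  kraus (Vstep V n.+1) (mxtens_index (i, y)) = kraus (Vstep V n) y *m kraus V i.
Proof.
rewrite !kraus_VstepE mulmx_suml.
rewrite (reindex (fun p : 'I_k * n.-tuple 'I_k => [tuple of p.1 :: p.2])) /=; last first.
  exists (fun w => (thead w, [tuple of behead w])) => [[j w] _|w _] /=.
    by rewrite theadE; congr pair; apply: val_inj.
  by rewrite -tuple_eta.
have ketE j (w : n.-tuple 'I_k) :
    ketn (tnth [tuple of j :: w]) (mxtens_index (i, y)) 0 =
    (i == j)%:R * ketn (tnth w) y 0 :> C.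
  have zE : (0 : 'I_1) = mxtens_index (ord0 : 'I_1, ord0 : 'I_1) by exact: val_inj.
  rewrite [in LHS]zE [LHS](tensmxE _ _ i y ord0 ord0) mxE andbT; congr (_ * _).
  rewrite -(@eq_ketn _ _ (fun l => tnth [tuple of j :: w] (lift ord0 l)) (tnth w)).
    by congr (ketn _ _ _); exact: val_inj.
  by move=> l; rewrite tnthS.
transitivity (\sum_j \sum_(w : n.-tuple 'I_k)
    ((i == j)%:R * ketn (tnth w) y 0) *: kraus_word V (j :: w)).
  by rewrite pair_big; apply: eq_bigr => -[j w] _; rewrite -ketE.
rewrite (bigD1 i) //= [X in _ + X]big1 ?addr0 => [|j ji].
  by apply: eq_bigr => w _; rewrite eqxx mul1r kraus_word_cons scalemxAl.
by rewrite big1 // => w _; rewrite eq_sym (negPf ji) mul0r scale0r.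
Qed.

Lemma transfer_Vstep d1 d2 k n (V1 : 'M[C]_(d1 * k, d1)) (V2 : 'M[C]_(d2 * k, d2)) X :
  transfer (Vstep V1 n) (Vstep V2 n) X = iter n (transfer V1 V2) X.
Proof.
elim: n => [|n IH].
  by rewrite /transfer big_ord1 !kraus_Vstep0 adjmx_scalar rmorph1 mul1mx mulmx1.
rewrite iterS -IH /transfer (@sum_mxtens_index _ k (tens_dim k n)).
apply: eq_bigr => i _; rewrite mulmx_sumr mulmx_suml; apply: eq_bigr => y _.
by rewrite !kraus_VstepS adjmxM !mulmxA.
Qed.

Lemma rho_outE d k n (V : 'M[C]_(d * k, d)) rho x y :
  rho_out V rho n x y =
    \tr (kraus (Vstep V n) x *m rho *m adjmx (kraus (Vstep V n) y)).
Proof.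
rewrite mxE; apply: eq_bigr => a _; rewrite !mxE; apply: eq_bigr => b _.
rewrite !adjmxE !mxE; congr (_ * _).
by apply: eq_bigr => c _; rewrite !mxE.
Qed.

(** By cyclicity the trace is that of [H^n(1) rho] with [V1 = V2 = V], and this [H] fixes the
    identity. *)
Lemma mxtrace_rho_out d k n (V : 'M[C]_(d * k, d)) rho :
  isometric V -> \tr (rho_out V rho n) = \tr rho.
Proof.
move=> isoV; have iter1 : iter n (transfer V V) 1%:M = 1%:M.
  by elim: n => //= n ->; apply: isometric_transfer1.
rewrite -[rho in RHS]mul1mx -iter1 -transfer_Vstep /transfer mulmx_suml raddf_sum.
apply: eq_bigr => x _ /=; by rewrite rho_outE mulmx1 mxtrace_mulC mulmxA.
Qed.

(* [A^* A] is a D x D matrix of trace 1, and the sum is its squared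
   Hilbert-Schmidt norm since [A^* B B^* A = (A^* A)^2]. *)
Lemma gram_overlap_ge N D D' (A : 'M[C]_(N, D)) (B : 'M[C]_(N, D')) :
    A *m adjmx A = B *m adjmx B -> \tr (A *m adjmx A) = 1 ->
  D%:R^-1 <= \sum_i \sum_j `|(adjmx A *m B) i j| ^+ 2.
Proof.
move=> AB trA; pose S := adjmx A *m A.
have -> : \sum_i \sum_j `|(adjmx A *m B) i j| ^+ 2 =
    \sum_i \sum_j `|S i j| ^+ 2.
  rewrite -!mxtrace_mul_adj /S !adjmxM !adjmxK -!mulmxA.
  by rewrite (mulmxA B) -AB !mulmxA.
have trS : \sum_i S i i = 1 by rewrite -trA mxtrace_mulC.
have S_real i : S i i \is Num.real.
  by rewrite CrealE -adjmxE /S adjmxM adjmxK.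
have D0 : (D%:R : C) != 0.
  rewrite pnatr_eq0; apply/eqP => D0; move: trS.
  rewrite big1 => [/eqP|i _]; first by rewrite eq_sym oner_eq0.
  by have := ltn_ord i; rewrite {2}D0.
(* Only the diagonal of [S] is kept; what remains is Cauchy-Schwarz, read off from the squared
   deviations of the diagonal from its mean [1 / D]. *)
apply: le_trans (_ : \sum_i S i i ^+ 2 <= _); last first.
  apply: ler_sum => i _; rewrite (bigD1 i) //= real_normK // lerDl.
  by apply: sumr_ge0 => j _; rewrite exprn_ge0.
have : 0 <= \sum_i (S i i - D%:R^-1) ^+ 2.
  by apply: sumr_ge0 => i _; rewrite real_exprn_even_ge0 // rpredB // rpredV realn.
have -> : \sum_i (S i i - D%:R^-1) ^+ 2 =
    \sum_i S i i ^+ 2 - D%:R^-1 * 2 * \sum_i S i i + D%:R^-1.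
  have {3}-> : D%:R^-1 = \sum_(i < D) D%:R^-1 ^+ 2 :> C.
    by rewrite sumr_const card_ord -[RHS]mulr_natl expr2 mulrA divff ?mul1r.
  rewrite mulr_sumr -sumrB -big_split; apply: eq_bigr => i _ /=; ring.
by rewrite trS mulr1 mulr_natr mulr2n opprD addrA subrK subr_ge0.
Qed.

(** The vector purifying the output state, reshaped as a matrix from the two auxiliary copies of the
    system space to the output space. Its [d * d] columns bound the rank of the output state for
    every [n]. *)
Definition purification d k n (V : 'M[C]_(d * k, d)) (M : 'M[C]_d) :
    'M[C]_(tens_dim k n, d * d) :=
  \matrix_(x, y) (kraus (Vstep V n) x *m M)
    (mxtens_unindex y).1 (mxtens_unindex y).2.

Lemma purification_gram d k n (V : 'M[C]_(d * k, d)) (M : 'M[C]_d) :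
  purification n V M *m adjmx (purification n V M) = rho_out V (M *m adjmx M) n.
Proof.
apply/matrixP => x y; rewrite rho_outE mxE sum_mxtens_index.
rewrite mulmxA -mulmxA -adjmxM; apply: eq_bigr => a _; rewrite mxE.
by apply: eq_bigr => b _; rewrite !adjmxE !mxE mxtens_indexK.
Qed.

Lemma mulmx_deltaE m n p q (P : 'M[C]_(m, n)) (Q : 'M_(p, q)) a b c e :
  (P *m delta_mx a c *m Q) b e = P b a * Q c e.
Proof.
rewrite -(mul_delta_mx (0 : 'I_1)) mulmxA -colE -mulmxA -rowE.
by rewrite mxE big_ord1 !mxE.
Qed.

(** In the sum over [x], the product of an entry of [(K_1x M1)^*] and an entry of [K_2x M2] is a
    matrix product through the unit [delta_mx a c], which puts a power of [H] between [M1^*] and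
    [M2]. *)
Lemma purification_overlap d1 d2 k n (V1 : 'M[C]_(d1 * k, d1))
    (V2 : 'M[C]_(d2 * k, d2)) (M1 : 'M[C]_d1) (M2 : 'M[C]_d2) a b c e :
  (adjmx (purification n V1 M1) *m purification n V2 M2)
    (mxtens_index (a, b)) (mxtens_index (c, e)) =
  (adjmx M1 *m iter n (transfer V1 V2) (delta_mx a c) *m M2) b e.
Proof.
rewrite -transfer_Vstep /transfer mulmx_sumr mulmx_suml summxE mxE.
apply: eq_bigr => x _; rewrite !mulmxA -adjmxM -mulmxA mulmx_deltaE !adjmxE.
by congr (Num.conj _ * _); rewrite mxE mxtens_indexK.
Qed.

End Output.

(** * Peripheral eigenvectors from equal outputs, and complex phases *)

Section Equivalence.
Context {R : realType}.
Let C : numClosedFieldType := R[i].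

Lemma output_equivalent_eigenvector d1 d2 k (V1 : 'M[C]_(d1 * k, d1))
    (V2 : 'M[C]_(d2 * k, d2)) rho1 rho2 :
    isometric V1 -> density rho1 -> density rho2 ->
    output_equivalent V1 rho1 V2 rho2 ->
  exists (X : 'M[C]_(d1, d2)) (l : C),
    [/\ X != 0, transfer V1 V2 X = l *: X & 1 <= `|l|].
Proof.
move=> iso1 [psd1 tr1] [psd2 _] out.
pose T := lin_mx (transfer V1 V2).
apply: contrapT => noX.
(* An eigenvector of the matrix [T] of [H], reshaped to [d1] by [d2], would be the [X] excluded by
   [noX]. *)
have T_lt1 z : eigenvalue T z -> `|z| < 1.
  move=> /eigenvalueP[v vT v0]; apply: contrapT => z_ge1; apply: noX.
  exists (vec_mx v), z; split.
  - by apply: contra_neq v0 => v0; rewrite -[v]vec_mxK v0 linear0.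
  - by rewrite -mx_rV_lin vT linearZ.
  - by rewrite real_leNgt //; apply/negP.
have [r [r0 r1 dec]] := decays_power T_lt1.
have [M1 rho1E] := psd_factor psd1; have [M2 rho2E] := psd_factor psd2.
pose Z n := adjmx (purification n V1 M1) *m purification n V2 M2.
have decE a c a' c' :
    decays r (fun n => iter n (transfer V1 V2) (delta_mx a c) a' c').
  apply: decays_ext (dec (mxvec (delta_mx a c)) (mxvec_index a' c')) => n.
  rewrite -[RHS]mxvecE; congr (fun_of_matrix _ _ _).
  by elim: n => //= n ->; rewrite mul_vec_lin.
have decZ i j : decays r (fun n => Z n i j).
  case: (mxtens_indexP i) => a b; case: (mxtens_indexP j) => c e.
  pose u n := \sum_c' \sum_a' (M2 c' e * adjmx M1 b a') *
    iter n (transfer V1 V2) (delta_mx a c) a' c'.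
  apply: (@decays_ext _ _ u) => [n|].
    rewrite /Z purification_overlap mxE; apply: eq_bigr => c' _.
    rewrite mxE mulr_suml; apply: eq_bigr => a' _; ring.
  by do 2!apply: decays_sum => ?; apply: decaysZ.
have decS : decays r (fun n => \sum_i \sum_j `|Z n i j| ^+ 2).
  do 2!apply: decays_sum => ?; apply: decays_sqr => //.
  by rewrite !ltW.
(* Trace 1 excludes [d1 = 0], where this inverse would be 0. *)
have D0 : 0 < ((d1 * d1)%:R^-1 : C).
  rewrite invr_gt0 ltr0n muln_gt0 andbb lt0n; apply/eqP => d0.
  move: tr1; rewrite /mxtrace big1 => [/eqP|i]; first by rewrite eq_sym oner_eq0.
  by have := ltn_ord i; rewrite {2}d0.
apply: decays_not_bounded_below r0 r1 D0 _ decS => n.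
rewrite ger0_norm; last by do 2!(apply: sumr_ge0 => ? _); rewrite exprn_ge0.
apply: gram_overlap_ge; rewrite !purification_gram -?rho1E -?rho2E //.
by rewrite mxtrace_rho_out.
Qed.

Lemma expi_norm (w : R) : `|expi w| = 1.
Proof.
by rewrite normc_def /= cos2Dsin2 sqrtr1.
Qed.

Lemma norm1_expi (z : C) : `|z| = 1 -> exists w, z = expi w.
Proof.
case: z => x y; rewrite normc_def => -[] /= xy1.
have {}xy1 : x ^+ 2 + y ^+ 2 = 1.
  by rewrite -[LHS]sqr_sqrtr ?xy1 ?expr1n // addr_ge0 // sqr_ge0.
have x_itv : -1 <= x <= 1.
  by rewrite -ler_norml -(@expr_le1 _ 2) // real_normK ?num_real // -xy1 lerDl sqr_ge0.
have s_acos : sin (acos x) = `|y|.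
  by rewrite sin_acos // -xy1 addrC addKr sqrtr_sqr.
have c_acos : cos (acos x) = x by apply: acosK; rewrite in_itv.
(* The sine of [acos x] is never negative, so the angle changes sign with [y]. *)
have [y0|y0] := lerP 0 y.
  by exists (acos x); rewrite /expi c_acos s_acos ger0_norm.
by exists (- acos x); rewrite /expi cosN sinN c_acos s_acos ltr0_norm // opprK.
Qed.

End Equivalence.

Theorem theorem6 (R : realType) (d1 d2 k : nat)
    (V1 : 'M[R[i]]_(d1 * k, d1)) (V2 : 'M[R[i]]_(d2 * k, d2))
    (rho1 : 'M[R[i]]_d1) (rho2 : 'M[R[i]]_d2)
    (isoV1 : isometric V1) (isoV2 : isometric V2)
    (irrV1 : irreducible V1) (irrV2 : irreducible V2)
    (ss1 : stationary V1 rho1) (ss2 : stationary V2 rho2) :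
  [<-> output_equivalent V1 rho1 V2 rho2;
       exists (W : 'M[R[i]]_(d1, d2)) (omega : R),
         [/\ unitary W,
             forall i : 'I_k, kraus V2 i =
               expi omega *: (adjmx W *m kraus V1 i *m W) &
             rho2 = adjmx W *m rho1 *m W];
       exists (W : 'M[R[i]]_(d1, d2)) (omega : R),
         unitary W /\
         (W *t (1%:M : 'M[R[i]]_k)) *m V2 = expi omega *: (V1 *m W)].
Proof.
tfae.
- move=> out; have [X [l [X0 Xl l1]]] :=
    output_equivalent_eigenvector isoV1 (proj1 ss1) (proj1 ss2) out.
  have [/norm1_expi[w ->] [W WP]] :=
    unitary_of_eigenvector isoV1 isoV2 irrV1 irrV2 ss1 ss2 X0 Xl l1.
  by exists W, w.
- move=> [W [w [uW KW _]]]; exists W, w; split=> //.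
  apply/matrixP => x b; case: (mxtens_indexP x) => a i.
  rewrite tensmx1_mulE KW -scalemxAr !mulmxA (proj2 uW) mul1mx [LHS]mxE [RHS]mxE.
  by rewrite mulmx_krausE.
- move=> [W [w [[WW _] WV]]] n.
  have WK i : W *m kraus V2 i = expi w *: (kraus V1 i *m W).
    apply/matrixP => a b.
    by rewrite -tensmx1_mulE WV [LHS]mxE [RHS]mxE mulmx_krausE.
  have W0 : W != 0.
    apply: contraTneq isT => W0.
    have := proj2 (proj1 ss2).
    rewrite -[rho2]mul1mx -WW W0 mulmx0 mul0mx mxtrace0 => /eqP.
    by rewrite eq_sym oner_eq0.
  have rho2_pos := irreducible_posdef irrV2 ss2.
  (* The relation between the stationary states, absent from (iii), is recovered from uniqueness of
     [rho1]; the proportionality factor is 1 because [W^* W = 1]. *)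
  have rhoW : W *m rho2 *m adjmx W = rho1.
    rewrite (intertwiner_stationary rho2_pos ss2 irrV1 ss1 W0 (expi_norm w) WK).
    by rewrite -mulmxA mxtrace_mulC -mulmxA WW mulmx1 (proj2 (proj1 ss2)) scale1r.
  (* Each letter contributes one phase; the total [expi w ^+ n] does not depend on [x], so it
     cancels against its conjugate in the output state. *)
  have WKn x : W *m kraus (Vstep V2 n) x = expi w ^+ n *: (kraus (Vstep V1 n) x *m W).
    elim: n x => [|n IH] x.
      by rewrite !kraus_Vstep0 expr0 scale1r mul1mx mulmx1.
    case: (mxtens_indexP (x : 'I_(k * tens_dim k n))) => i y.
    rewrite !kraus_VstepS mulmxA IH -scalemxAl -(mulmxA _ W) WK -scalemxAr scalerA.
    by rewrite -exprSr mulmxA.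
  apply/matrixP => x y; rewrite !rho_outE -rhoW.
  set B1 := kraus (Vstep V1 n); set B2 := kraus (Vstep V2 n).
  have -> : B1 x *m (W *m rho2 *m adjmx W) *m adjmx (B1 y) =
      (B1 x *m W) *m rho2 *m adjmx (B1 y *m W).
    by rewrite adjmxM !mulmxA.
  transitivity (\tr ((W *m B2 x) *m rho2 *m adjmx (W *m B2 y))).
    rewrite !WKn adjmxZ -!scalemxAl -scalemxAr scalerA -normCK normrX expi_norm.
    by rewrite !expr1n scale1r.
  by rewrite adjmxM -!mulmxA mxtrace_mulC -!mulmxA WW mulmx1.
Qed.
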